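(* Let $p\geq 7$ be a prime number. Consider the left braces, up to isomorphism, with additive group $\mathbf{Z}_p\times(C_6\times C_2)$ and multiplicative group a semidirect product $\mathbf{Z}_p\rtimes(C_6\times C_2)$. 1) If $p\equiv 11\pmod{12}$ there are 2 such braces. One of them is a direct product and the second one has a kernel of order 6. 2) If $p\equiv 7\pmod{12}$ there are 4 such braces. One of them is a direct product, and the other three have kernels of orders 2, 6 and 4, respectively. 3) If $p\equiv 5\pmod{12}$ there are 2 such braces. One of them is a direct product and the second one has a kernel of order 6. 4) If $p\equiv 1\pmod{12}$ there are 4 such braces. One of them is a direct product, and the other three have kernels of orders 2, 6 and 4, respectively.
   Context: A left brace is a set $B$ with operations $+,\cdot$ such that $(B,+)$ is an abelian group (additive group), $(B,\cdot)$ is a group (multiplicative group), and $a(b+c)=ab-a+ac$ for all $a,b,c\in B$. Isomorphisms are bijections preserving both operations. $\mathbf{Z}_m=\mathbf{Z}/m\mathbf{Z}$ and $C_m$ is the cyclic group of order $m$. Given a left brace $B'$ of size 12 with multiplicative group $F$ and a group morphism $\tau:F\to\mathrm{Aut}(\mathbf{Z}_p)\simeq\mathbf{Z}_p^*$, the semidirect product of the trivial brace $\mathbf{Z}_p$ (with $a\cdot b=a+b$) and $B'$ via $\tau$ is $\mathbf{Z}_p\times B'$ with componentwise addition and $(a,b)\cdot(a',b')=(a+\tau(b)a',bb')$; it is the direct product of braces when $\tau$ is trivial. For $p\geq 7$ every left brace of size $12p$ is isomorphic to one of this form. The kernel of the brace means $\ker\tau\subseteq F$. ''Multiplicative group $\mathbf{Z}_p\rtimes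 F$'' means isomorphic to $\mathbf{Z}_p\rtimes_\tau F$ for some $\tau$, possibly trivial. *)

(* Defs.v *)
From HB Require Import structures.
From mathcomp Require Import all_boot all_order all_algebra all_fingroup.
Set Implicit Arguments.
Unset Strict Implicit.
Unset Printing Implicit Defensive.
Import GRing.Theory.
Local Open Scope ring_scope.

HB.mixin Record isLeftBrace B of GRing.Zmodule B & monoid.Group B := {
  brace_distr : forall a b c : B, (a * (b + c)%R)%g = (a * b)%g - a + (a * c)%g
}.

#[short(type="leftBraceType")]
HB.structure Definition LeftBrace :=
  {B of isLeftBrace B & GRing.Zmodule B & monoid.Group B}.

#[short(type="finLeftBraceType")]
HB.structure Definition FinLeftBrace := {B of LeftBrace B & Finite B}.

Definition zmod_iso (U V : zmodType) : Prop :=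
  exists2 f : U -> V, bijective f & {morph f : x y / x + y}.

Definition group_iso (G H : groupType) : Prop :=
  exists2 f : G -> H, bijective f & {morph f : x y / (x * y)%g}.

Definition brace_iso (A B : leftBraceType) : Prop :=
  exists f : A -> B,
    [/\ bijective f, {morph f : x y / x + y} & {morph f : x y / (x * y)%g}].

(* The carrier is a fresh name for 'F_p * F because the pair type already has
   a (direct product) group structure; Aut(Z_p) is identified with the unit
   group of 'F_p, acting by multiplication. *)
Definition semidirect (p : nat) (F : groupType)
  (tau : {multiplicative F -> {unit 'F_p}}) : Type := ('F_p * F)%type.

Section SemidirectGroup.
Variables (p : nat) (F : groupType) (tau : {multiplicative F -> {unit 'F_p}}).
Local Notation T := (semidirect tau).

HB.instance Definition _ := Choice.on T.

Definition semidirect_one : T := (0, 1%g).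
Definition semidirect_mul (x y : T) : T :=
  (x.1 + val (tau x.2) * y.1, (x.2 * y.2)%g).
Definition semidirect_inv (x : T) : T :=
  (- (val (tau x.2^-1%g) * x.1), x.2^-1%g).

Let tau1 : tau 1%g = 1%g.
Proof. by apply: (mulgI (tau 1%g)); rewrite -gmulfM !mulg1. Qed.

Fact semidirect_mulA : associative semidirect_mul.
Proof.
move=> x y z; congr (_, _) => /=; last exact: mulgA.
by rewrite gmulfM /= mulrDr mulrA addrA.
Qed.

Fact semidirect_mul1 : left_id semidirect_one semidirect_mul.
Proof.
by case=> a b; congr (_, _) => /=; rewrite ?mul1g // tau1 /= mul1r add0r.
Qed.

Fact semidirect_1mul : right_id semidirect_one semidirect_mul.
Proof. by case=> a b; congr (_, _) => /=; rewrite ?mulg1 // mulr0 addr0. Qed.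

Fact semidirect_mulV :
  left_inverse semidirect_one semidirect_inv semidirect_mul.
Proof. by move=> x; congr (_, _) => /=; rewrite ?mulVg // addNr. Qed.

Fact semidirect_Vmul :
  right_inverse semidirect_one semidirect_inv semidirect_mul.
Proof.
case=> a b; congr (_, _) => /=; last exact: mulgV.
have -> : val (tau b) * - (val (tau b^-1%g) * a)
        = - (val (tau b * tau b^-1)%g * a) by rewrite /= mulrN mulrA.
by rewrite -gmulfM mulgV tau1 /= mul1r subrr.
Qed.

HB.instance Definition _ := isGroup.Build T semidirect_mulA semidirect_mul1
  semidirect_1mul semidirect_mulV semidirect_Vmul.

End SemidirectGroup.

Section SemidirectBrace.
Variables (p : nat) (B : leftBraceType).
Variable tau : {multiplicative B -> {unit 'F_p}}.
Local Notation T := (semidirect tau).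

HB.instance Definition _ := GRing.Zmodule.copy T ('F_p * B)%type.

Fact semidirect_distr (a b c : T) :
  (a * (b + c)%R)%g = (a * b)%g - a + (a * c)%g.
Proof.
case: a b c => [a1 a2] [b1 b2] [c1 c2]; congr (_, _) => /=.
  by rewrite mulrDr (addrC a1 (_ * b1)) addrK addrCA.
exact: brace_distr.
Qed.

HB.instance Definition _ := isLeftBrace.Build T semidirect_distr.

End SemidirectBrace.

(* 'Z_6 * 'Z_2 is C_6 x C_2: as a zmodType through its ring structure, and as
   a groupType through the componentwise product, 'Z_n being viewed in the
   library as a (multiplicatively written) group for its addition. *)
Notation C6C2 := ('Z_6 * 'Z_2)%type.

Definition C6C2_brace (p : nat) (B : leftBraceType) : Prop :=
  zmod_iso B ('F_p * C6C2)%type /\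
  exists tau : {multiplicative C6C2 -> {unit 'F_p}},
    group_iso B (semidirect tau).

Definition iso_representatives (P : leftBraceType -> Prop) (n : nat)
    (s : 'I_n -> leftBraceType) : Prop :=
  [/\ forall i, P (s i),
      forall i j, brace_iso (s i) (s j) -> i = j
    & forall B, P B -> exists i, brace_iso B (s i)].

Definition semidirect_form (p : nat) (B : leftBraceType) (B' : finLeftBraceType)
    (tau : {multiplicative B' -> {unit 'F_p}}) : Prop :=
  #|B'| = 12%N /\ brace_iso B (semidirect tau).

Definition is_direct_product (p : nat) (B : leftBraceType) : Prop :=
  exists (B' : finLeftBraceType) (tau : {multiplicative B' -> {unit 'F_p}}),
    semidirect_form B tau /\ forall b, tau b = 1%g.

(* The second clause says that the order of the kernel does not depend on the
   way B is written as a semidirect product. *)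
Definition has_kernel_order (p k : nat) (B : leftBraceType) : Prop :=
  (exists (B' : finLeftBraceType) (tau : {multiplicative B' -> {unit 'F_p}}),
     semidirect_form B tau) /\
  forall (B' : finLeftBraceType) (tau : {multiplicative B' -> {unit 'F_p}}),
    semidirect_form B tau -> #|[set b | tau b == 1%g]| = k.

(* Main.v *)
Require Import Defs.
From HB Require Import structures.
From mathcomp Require Import all_boot all_order all_algebra all_fingroup.
From mathcomp Require Import cyclic pgroup ring zify.

(** Write lam a b = a b - a for the map of a left brace B.  The map a |-> lam a
    is an action of the multiplicative group of B on its additive group, and
    a b = a + lam a b, so that B is known once lam is.

    Every brace in question is a semidirect product of F_p and the trivial
    brace on C6 x C2.  Let P and Q be the sets of elements of B killed by p and
    by 6 for the addition; they are stable under lam, hence under products.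
    On P, a cyclic group of prime order p, lam a is multiplication by a scalar
    u, and if u <> 1 then a + u b = b has a solution b, that is a b = b, which
    forces a = 0; so P acts trivially on itself, its product is its sum, and
    its p elements make up the kernel of the projection pi of the
    multiplicative group F_p x| (C6 x C2) onto C6 x C2 (after an injection
    between finite sets of the same size).  Thus P is normal, and comparing
    the two additive components in a c = c a^c gives that P acts trivially on
    Q.  As pi has values in an abelian group of exponent 6 and is injective on
    Q, the product of Q is commutative of exponent 6, and this makes Q act
    trivially on itself (lam_torsion6): commuting elements of coprime additive
    orders act trivially on each other, the 3-torsion is treated like P, and in the
    2-torsion, a Klein four-group, exponent 6 excludes the only other
    commutative structure, the cyclic one.  What remains of lam is the action
    of Q on P by scalars (C6C2_brace_iso_semidirect).

    A morphism tau from C6 x C2 to the units of F_p is determined up to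
    automorphisms of C6 x C2, which are brace automorphisms, as follows.  One
    of the three involutions lies in its kernel; taking it as the 2-part of the
    generator of order 6, tau sends this generator to some c with c^3 = 1 and
    the complementary involution to some e = 1 or e = -1 (iso_std), and c may
    be replaced by its inverse (iso_stdV).  Apart from 1, there are cube roots
    of unity in F_p only if p = 1 mod 3, and then they are mutually inverse:
    this leaves 2 or 4 braces.

    They are told apart by the order of ker tau, which is an invariant:
    F_p x ker tau is the multiplicative centraliser of the additive p-torsion
    (semidirect_iso_card_ker). *)

Set Implicit Arguments.
Unset Strict Implicit.
Unset Printing Implicit Defensive.
Import GRing.Theory.

(** * Torsion and the lambda map of a left brace *)

Section Torsion.
Local Open Scope ring_scope.
Variable V : zmodType.

Lemma coprime_torsion_eq0 (m n : nat) (x : V) :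
  coprime m n -> x *+ m = 0 -> x *+ n = 0 -> x = 0.
Proof.
case: m => [|m] co xm xn.
  by move: co; rewrite /coprime gcd0n => /eqP n1; rewrite -[x]mulr1n -n1.
have [u v Bz _] := @egcdnP m.+1 n isT.
have : x *+ (u * m.+1) = 0 by rewrite mulnC mulrnA xm mul0rn.
by rewrite Bz mulrnDr mulnC mulrnA xn mul0rn add0r (eqP co).
Qed.
End Torsion.

Section Lambda.
Local Open Scope ring_scope.
Variable B : leftBraceType.
Implicit Types a b c : B.

Definition lam a b : B := (a * b)%g - a.

Lemma brace_mulE a b : (a * b)%g = a + lam a b.
Proof. by rewrite addrC subrK. Qed.

Lemma brace_one : (1%g : B) = 0.
Proof.
have := brace_distr (1%g : B) 0 0; rewrite !mul1g !addr0 sub0r.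
by move/(congr1 -%R); rewrite opprK oppr0.
Qed.

Fact lam_additive a : zmod_morphism (lam a).
Proof.
move=> b c; rewrite /lam opprB addrA subrK.
have := brace_distr a (b - c) c; rewrite subrK => ->.
by rewrite addrK.
Qed.
HB.instance Definition _ a :=
  GRing.isZmodMorphism.Build B B (lam a) (lam_additive a).

Lemma lamM a b c : lam (a * b)%g c = lam a (lam b c).
Proof. by rewrite {3}/lam raddfB /= /lam !mulgA opprB addrA subrK. Qed.

Lemma lam0 c : lam 0 c = c.
Proof. by rewrite -brace_one /lam mul1g brace_one subr0. Qed.

(** The hypothesis says a b = b. *)
Lemma lam_fixfree a b : lam a b = b - a -> a = 0.
Proof.
move=> ab; rewrite -brace_one; apply: (mulIg b).
by rewrite mul1g brace_mulE ab addrC subrK.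
Qed.

Lemma torsion_lam n a b : b *+ n = 0 -> lam a b *+ n = 0.
Proof. by move=> bn; rewrite -raddfMn bn raddf0. Qed.

Lemma torsion_mulg n a b : a *+ n = 0 -> b *+ n = 0 -> (a * b)%g *+ n = 0.
Proof. by move=> an bn; rewrite brace_mulE mulrnDl an torsion_lam ?addr0. Qed.

(** As a b = b a reads a + lam a b = b + lam b a, the difference lam a b - b
    equals lam b a - a, hence is both m-torsion and n-torsion. *)
Lemma lam_torsion_coprime m n a b : coprime m n ->
  a *+ m = 0 -> b *+ n = 0 -> (a * b = b * a)%g -> lam a b = b.
Proof.
move=> co am bn ab; apply/eqP; rewrite -subr_eq0; apply/eqP.
apply: (coprime_torsion_eq0 co); last first.
  by rewrite mulrnBl torsion_lam // bn subr0.
have -> : lam a b - b = lam b a - a.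
  rewrite {1}/lam ab brace_mulE [X in X - a]addrC -!addrA [b + _]addrCA subrr.
  by rewrite addr0.
by rewrite mulrnBl torsion_lam // am subr0.
Qed.

(** On a cyclic q-torsion lam a is multiplication by a scalar u.  If u <> 1,
    then b = a / (1 - u) satisfies lam a b = u b = b - a, and this forces
    a = 0. *)
Lemma lam_torsion_cyclic q (i : {additive 'F_q -> B}) a b : prime q ->
  (forall x : B, x *+ q = 0 -> exists u, x = i u) ->
  a *+ q = 0 -> b *+ q = 0 -> lam a b = b.
Proof.
move=> q_pr surj aq /surj[y ->{b}].
have iE u x : i (x * u) = i u *+ x by rewrite -raddfMn -mulr_natl natr_Zp.
have [u iu] : exists u, lam a (i 1) = i u.
  by apply/surj/torsion_lam; rewrite -raddfMn pchar_Fp_0 // raddf0.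
have lamE x : lam a (i x) = i (x * u).
  by rewrite -[x in LHS]mulr1 !iE raddfMn -iu.
have [x ax] := surj _ aq.
rewrite lamE; have [->|u1] := eqVneq u 1; first by rewrite mulr1.
have u1' : 1 - u != 0 by rewrite subr_eq0 eq_sym.
suff a0 : a = 0 by rewrite -lamE a0 lam0.
apply: (@lam_fixfree _ (i (x / (1 - u)))).
rewrite lamE ax -raddfB; congr (i _).
apply: (mulIf u1'); rewrite mulrBl mulfVK // mulrAC mulfVK // mulrBr mulr1.
by rewrite opprB addrC subrK.
Qed.

(** The hypothesis on x, y and z says that the 2-torsion has order at most 4.
    If a a = 1, then lam a fixes a; for a <> 0 and b outside {0, a} it cannot
    map b to 0 or a by injectivity, nor to a + b = b - a by lam_fixfree. *)
Lemma lam_torsion_klein a b :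
  (forall x y z : B, x *+ 2 = 0 -> y *+ 2 = 0 -> z *+ 2 = 0 ->
     x != 0 -> y != 0 -> x != y -> z \in [:: 0; x; y; x + y]) ->
  a *+ 2 = 0 -> b *+ 2 = 0 -> (a ^+ 6 = 1)%g -> lam a b = b.
Proof.
move=> klein a2 b2 a6; have opp2 (x : B) : x *+ 2 = 0 -> - x = x.
  by move=> x2; apply/esym/eqP; rewrite -addr_eq0 -mulr2n x2.
have aa : (a * a = 1)%g.
  (* The cube of w = a a is 1, which reads w + lam w w + lam w (lam w w) = 0.
     In the 2-torsion this is the hypothesis of lam_fixfree for lam w w, so
     that w = 0. *)
  set w := (a * a)%g; have w2 : w *+ 2 = 0 by exact: torsion_mulg.
  have : lam w (lam w w) + (w + lam w w) = 0.
    rewrite addrC -addrA -raddfD /= -!brace_mulE -brace_one -a6 /w.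
    by rewrite !expgS expg0 !mulgA mulg1.
  move/eqP; rewrite addr_eq0 opprD (opp2 (lam w w)) ?torsion_lam // addrC.
  by move/eqP/lam_fixfree => ->; rewrite brace_one.
have lamaa : lam a a = a by rewrite /lam aa brace_one add0r opp2.
have [->|a0] := eqVneq a 0; first exact: lam0.
have [->|b0] := eqVneq b 0; first exact: raddf0.
have [<- //|ab] := eqVneq a b.
have lam_inj x : lam a x = 0 -> x = 0.
  move=> h; rewrite -[x]lam0 -brace_one -(mulVg a) lamM h raddf0.
  by rewrite mulVg brace_one.
have := klein a b (lam a b) a2 b2 (torsion_lam a b2) a0 b0 ab.
rewrite !inE => /or4P[] /eqP // h.
- by move: b0; rewrite (lam_inj _ h) eqxx.
- have : b - a = 0 by apply: lam_inj; rewrite raddfB /= h lamaa subrr.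
  by move/eqP; rewrite subr_eq0 eq_sym (negPf ab).
by move: a0; rewrite (@lam_fixfree a b) ?eqxx // h opp2 // addrC.
Qed.
End Lambda.

(** * The trivial brace on C6 x C2 *)

(** The group law of C6 x C2 is convertible to its addition, so that this type
    is itself the trivial brace. *)
Fact C6C2_trivial_distr (a b c : C6C2) :
  ((a * (b + c)%R)%g = (a * b)%g - a + (a * c)%g)%R.
Proof.
have E (x y : C6C2) : (x * y)%g = (x + y)%R by [].
by rewrite !E [(a + b - a)%R]addrAC subrr add0r addrCA.
Qed.
HB.instance Definition _ := isLeftBrace.Build C6C2 C6C2_trivial_distr.

Section C6C2Compute.
Local Open Scope ring_scope.

(** Computation goes through on this explicit list, whereas the enumeration of
    the finite type is locked. *)
Lemma C6C2_forall (Pr : pred C6C2) :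
  all Pr [seq (inZp i, inZp j) | i <- iota 0 6, j <- iota 0 2] ->
  forall v, Pr v.
Proof.
move/allP=> PrP [x y]; apply: PrP.
by rewrite -[x]valZpK -[y]valZpK; apply: allpairs_f; rewrite mem_iota ltn_ord.
Qed.

Lemma C6C2_mulrn6 (v : C6C2) : v *+ 6 = 0.
Proof. by apply/eqP; move: v; apply: C6C2_forall. Qed.

Definition F3_to_C6C2 (u : 'F_3) : C6C2 := (inZp (val u).*2, 0).

Fact F3_to_C6C2_additive : zmod_morphism F3_to_C6C2.
Proof. by move=> [[|[|[|//]]] ?] [[|[|[|//]]] ?]; apply/eqP. Qed.
HB.instance Definition _ :=
  GRing.isZmodMorphism.Build _ _ F3_to_C6C2 F3_to_C6C2_additive.

Lemma C6C2_torsion3 (v : C6C2) : v *+ 3 = 0 -> exists u, v = F3_to_C6C2 u.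
Proof.
move/eqP=> v3; exists (inZp (val v.1).*2); apply/eqP.
by apply/(implyP _ v3); move: v {v3}; apply: C6C2_forall.
Qed.

Lemma C6C2_torsion2 (v : C6C2) : v *+ 2 = 0 ->
  v \in [:: (0, 0); (inZp 3, 0); (0, 1); (inZp 3, 1)].
Proof.
by move/eqP=> v2; apply/(implyP _ v2); move: v {v2}; apply: C6C2_forall.
Qed.

Lemma C6C2_klein (x y z : C6C2) : x *+ 2 = 0 -> y *+ 2 = 0 -> z *+ 2 = 0 ->
  x != 0 -> y != 0 -> x != y -> z \in [:: 0; x; y; x + y].
Proof.
move=> /C6C2_torsion2 + /C6C2_torsion2 + /C6C2_torsion2.
by rewrite !inE; do 3![case/or4P=> /eqP->].
Qed.
End C6C2Compute.

(** * Reduction to a semidirect product of trivial braces *)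

Section Structure.
Local Open Scope ring_scope.
Variables (p : nat) (B : leftBraceType).
Hypotheses (p_pr : prime p) (co6 : coprime p 6).
Variable h : {additive ('F_p * C6C2)%type -> B}.
Variable f : B -> ('F_p * C6C2)%type.
Hypotheses (hK : cancel h f) (fK : cancel f h).
Variable pi : UMagmaMorphism.type B C6C2.
Hypothesis ker_pi : forall a, pi a = 1%g <-> a *+ p = 0.

Definition inP (x : 'F_p) : B := h (x, 0).
Definition inQ (v : C6C2) : B := h (0, v).

Fact inP_additive : zmod_morphism inP.
Proof.
by move=> x y; rewrite /inP -raddfB; congr (h (_, _)); rewrite subr0.
Qed.
HB.instance Definition _ := GRing.isZmodMorphism.Build _ _ inP inP_additive.

Fact inQ_additive : zmod_morphism inQ.
Proof.
by move=> x y; rewrite /inQ -raddfB; congr (h (_, _)); rewrite subr0.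
Qed.
HB.instance Definition _ := GRing.isZmodMorphism.Build _ _ inQ inQ_additive.

Lemma inPQ b : b = inP (f b).1 + inQ (f b).2.
Proof.
rewrite /inP /inQ -raddfD -{1}[b]fK; congr (h _).
by case: (f b) => x v; congr (_, _); rewrite /= ?addr0 ?add0r.
Qed.

Lemma inP_torsion x : inP x *+ p = 0.
Proof. by rewrite -raddfMn -mulr_natl pchar_Fp_0 // mul0r raddf0. Qed.

Lemma inQ_torsion v : inQ v *+ 6 = 0.
Proof. by rewrite -raddfMn C6C2_mulrn6 raddf0. Qed.

Lemma torsion_p_6_eq0 (b : B) : b *+ p = 0 -> b *+ 6 = 0 -> b = 0.
Proof. exact: coprime_torsion_eq0. Qed.

Lemma torsion_pP (b : B) : b *+ p = 0 -> b = inP (f b).1.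
Proof.
move=> bp; rewrite {1}[b]inPQ (@torsion_p_6_eq0 (inQ _)) ?addr0 ?inQ_torsion //.
by move: bp; rewrite {1}[b]inPQ mulrnDl inP_torsion add0r.
Qed.

Lemma torsion_6P (b : B) : b *+ 6 = 0 -> b = inQ (f b).2.
Proof.
move=> b6; rewrite {1}[b]inPQ (@torsion_p_6_eq0 (inP _)) ?add0r ?inP_torsion //.
by move: b6; rewrite {1}[b]inPQ mulrnDl inQ_torsion addr0.
Qed.

Lemma inQ_inj : injective inQ.
Proof. by move=> v w /(can_inj hK)[]. Qed.

Lemma lam_torsion_pp (a b : B) : a *+ p = 0 -> b *+ p = 0 -> lam a b = b.
Proof.
by apply: (@lam_torsion_cyclic _ _ inP) => // x /torsion_pP->; eexists.
Qed.

(** Being the kernel of pi, the p-torsion is normal.  For c in the 6-torsion,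
    a c = c a^c reads lam a c - c = lam c (a^c) - a, with the left-hand side in
    the 6-torsion and the right-hand side in the p-torsion. *)
Lemma lam_torsion_p (a b : B) : a *+ p = 0 -> lam a b = b.
Proof.
move=> ap; rewrite [b]inPQ raddfD /=; congr (_ + _).
  by apply: lam_torsion_pp; rewrite ?inP_torsion.
set c := inQ _; pose a' := (a ^ c)%g.
have a'p : a' *+ p = 0.
  by apply/ker_pi; rewrite gmulfJ (proj2 (ker_pi a)) // conj1g.
apply/eqP; rewrite -subr_eq0; apply/eqP/torsion_p_6_eq0; last first.
  by rewrite mulrnBl torsion_lam ?inQ_torsion ?subrr.
suff -> : lam a c - c = lam c a' - a by rewrite mulrnBl torsion_lam // ap subr0.
have := conjgC a c; rewrite !brace_mulE -/a' => E.
by apply/eqP; rewrite subr_eq addrAC eq_sym subr_eq [_ + a]addrC E addrC.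
Qed.

(** The commutator c of a and b lies in the kernel of pi, so it is p-torsion and
    acts trivially: a b = c (b a) = c + b a.  Hence c is also 6-torsion. *)
Lemma torsion6_mulC (a b : B) : a *+ 6 = 0 -> b *+ 6 = 0 -> (a * b = b * a)%g.
Proof.
move=> a6 b6; pose c := (a * b * (b * a)^-1)%g.
have cE : (a * b = c * (b * a))%g by rewrite mulgVK.
have cp : c *+ p = 0.
  apply/ker_pi; rewrite gmulfM gmulfV !gmulfM.
  by rewrite (_ : pi b * pi a = pi a * pi b)%g ?mulgV //; apply: addrC.
have ab6 := torsion_mulg a6 b6; have ba6 := torsion_mulg b6 a6.
have c0 : c = 0.
  apply: torsion_p_6_eq0 => //; move: ab6.
  by rewrite cE brace_mulE lam_torsion_p // mulrnDl ba6 addr0.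
by rewrite cE c0 -brace_one mul1g.
Qed.

Lemma torsion_expg n (a : B) k : a *+ n = 0 -> (a ^+ k)%g *+ n = 0.
Proof.
move=> an; elim: k => [|k IHk]; first by rewrite expg0 brace_one mul0rn.
by rewrite expgS torsion_mulg.
Qed.

(** The sixth power lies in the kernel of pi, that is in the p-torsion. *)
Lemma torsion6_expg6 (a : B) : a *+ 6 = 0 -> (a ^+ 6 = 1)%g.
Proof.
move=> a6; rewrite brace_one; apply: torsion_p_6_eq0; last exact: torsion_expg.
by apply/ker_pi; rewrite gmulfXn; exact: C6C2_mulrn6.
Qed.

(** Every x in the 6-torsion is 3 x + 4 x, with 3 x in the 2-torsion and 4 x in
    the 3-torsion; the four mutual actions of these parts are trivial. *)
Lemma lam_torsion6 (a b : B) : a *+ 6 = 0 -> b *+ 6 = 0 -> lam a b = b.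
Proof.
have split6 (x : B) : x *+ 6 = 0 -> x = x *+ 3 + x *+ 4.
  by move=> x6; rewrite -mulrnDr (mulrnDr x 6 1) x6 add0r.
have t2 (x : B) : x *+ 6 = 0 -> x *+ 3 *+ 2 = 0 by rewrite -mulrnA.
have t3 (x : B) : x *+ 6 = 0 -> x *+ 4 *+ 3 = 0.
  by move=> x6; rewrite -mulrnA (mulrnA x 6 2) x6 mul0rn.
have t6 (x : B) n : x *+ 6 = 0 -> x *+ n *+ 6 = 0.
  by move=> x6; rewrite -mulrnA mulnC mulrnA x6 mul0rn.
have lam2 (x y : B) : x *+ 6 = 0 -> y *+ 6 = 0 -> lam (x *+ 3) y = y.
  move=> x6 y6; rewrite [y]split6 // raddfD /=; congr (_ + _).
    apply: lam_torsion_klein (t2 _ x6) (t2 _ y6) _;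
      last exact/torsion6_expg6/t6.
    move=> u v w u2 v2 w2.
    have Q2 (z : B) : z *+ 2 = 0 -> z = inQ (f z).2 /\ (f z).2 *+ 2 = 0.
      move=> z2; have zE : z = inQ (f z).2.
        by apply: torsion_6P; rewrite (mulrnA z 2 3) z2 mul0rn.
      by split=> //; apply: inQ_inj; rewrite raddfMn /= -zE z2 raddf0.
    have [uE uQ2] := Q2 u u2; have [vE vQ2] := Q2 v v2.
    have [wE wQ2] := Q2 w w2.
    rewrite uE vE wE; move: (f u).2 (f v).2 (f w).2 uQ2 vQ2 wQ2.
    move=> {uE u2 vE v2 wE w2}u {}v {}w u2 v2 w2.
    rewrite -raddfD -(raddf0 inQ) !(inj_eq inQ_inj) => u0 v0 uv.
    by rewrite (mem_map inQ_inj [:: 0; u; v; u + v]); exact: C6C2_klein.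
  apply: (@lam_torsion_coprime _ 2 3) => //; [exact: t2|exact: t3|].
  by apply: torsion6_mulC; exact: t6.
have lam3 (x y : B) : x *+ 6 = 0 -> y *+ 6 = 0 -> lam (x *+ 4) y = y.
  move=> x6 y6; rewrite [y]split6 // raddfD /=; congr (_ + _).
    apply: (@lam_torsion_coprime _ 3 2) => //; [exact: t3|exact: t2|].
    by apply: torsion6_mulC; exact: t6.
  apply: (@lam_torsion_cyclic _ 3 (inQ \o F3_to_C6C2)) => //;
    [|exact: t3|exact: t3].
  move=> z z3; have zE : z = inQ (f z).2.
    by apply: torsion_6P; rewrite (mulrnA z 3 2) z3 mul0rn.
  have [|u fz] := @C6C2_torsion3 (f z).2.
    by apply: inQ_inj; rewrite raddfMn /= -zE z3 raddf0.
  by exists u; rewrite zE fz.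
move=> a6 b6; rewrite [a]split6 // -[X in _ + X](lam2 a) ?t6 // -brace_mulE.
by rewrite lamM lam3 // lam2.
Qed.

Definition scalar (v : C6C2) : 'F_p := (f (lam (inQ v) (inP 1))).1.

Lemma lam_inQ_inP v x : lam (inQ v) (inP x) = inP (scalar v * x).
Proof.
rewrite -[x]natr_Zp mulr_natr !raddfMn /=; congr (_ *+ _).
by apply: torsion_pP; rewrite torsion_lam // inP_torsion.
Qed.

Lemma inP_inj : injective inP.
Proof. by move=> v w /(can_inj hK)[]. Qed.

Lemma inQM v w : inQ (v + w) = (inQ v * inQ w)%g.
Proof. by rewrite brace_mulE lam_torsion6 ?inQ_torsion // raddfD. Qed.

Lemma scalarD v w : scalar (v + w) = scalar v * scalar w.
Proof.
rewrite -[RHS]mulr1 -mulrA; apply: inP_inj.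
by rewrite -!lam_inQ_inP -lamM -inQM lam_inQ_inP mulr1.
Qed.

Lemma scalar_unit v : scalar v \is a GRing.unit.
Proof.
have scalar0 : scalar 0 = 1.
  by apply: inP_inj; rewrite -[scalar 0]mulr1 -lam_inQ_inP raddf0 lam0.
have : scalar v * scalar (- v) \is a GRing.unit.
  by rewrite -scalarD subrr scalar0 unitr1.
by rewrite unitrM => /andP[].
Qed.

Definition action v : {unit 'F_p} := FinRing.Unit (scalar_unit v).

Fact actionM : {morph action : v w / (v * w)%g}.
Proof. by move=> v w; apply/val_inj/scalarD. Qed.
HB.instance Definition _ := isMultiplicative.Build _ _ action actionM.

(** In coordinates x = P(x1) Q(x2) = P(x1) + Q(x2), and by the lemmas above
    lam x is multiplication by scalar x2 on the first component and the
    identity on the second one. *)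
Lemma iso_semidirect_C6C2 :
  exists tau : {multiplicative C6C2 -> {unit 'F_p}},
    brace_iso B (semidirect tau).
Proof.
have fD : {morph f : x y / x + y}.
  by move=> x y; apply: (can_inj hK); rewrite raddfD !fK.
exists action, (f : B -> semidirect action); split => //; first by exists h.
move=> x y; apply: (can_inj hK); rewrite fK.
case fx: (f x) => [x1 x2]; case fy: (f y) => [y1 y2].
have -> : x = (inP x1 * inQ x2)%g.
  by rewrite brace_mulE lam_torsion_p ?inP_torsion // [x in LHS]inPQ fx.
rewrite brace_mulE lamM lam_torsion_p ?inP_torsion // [y]inPQ fy raddfD /=.
rewrite lam_inQ_inP lam_torsion6 ?inQ_torsion //.
rewrite brace_mulE lam_torsion_p ?inP_torsion //.
by rewrite [RHS](inPQ (h _)) hK /= !raddfD /= addrACA.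
Qed.
End Structure.

Section Projection.
Local Open Scope ring_scope.
Variables (p : nat) (B : leftBraceType).
Hypotheses (p_pr : prime p) (co6 : coprime p 6).

(** The projection pi of the multiplicative group onto C6 x C2 kills the
    additive p-torsion, whose elements satisfy a^p = 1.  The p-torsion
    therefore embeds into the factor F_p of the multiplicative group; as both
    have p elements, it is the whole kernel of pi. *)
Lemma C6C2_brace_iso_semidirect : C6C2_brace p B ->
  exists tau : {multiplicative C6C2 -> {unit 'F_p}},
    brace_iso B (semidirect tau).
Proof.
case=> -[f [f' fK f'K] fD] [sigma [g [g' gK g'K] gM]].
have f'D : zmod_morphism f'.
  move=> x y; apply: (can_inj fK); apply: (addIr (f (f' y))).
  by rewrite f'K -fD subrK !f'K subrK.
pose hM := GRing.isZmodMorphism.Build _ _ f' f'D.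
pose h : {additive _ -> _} := HB.pack f' hM.
have pi_mul : @monoid.monoid_morphism B C6C2 (fun a => (g a).2).
  split; last by move=> a b; rewrite gM.
  suff -> : g 1%g = 1%g by [].
  by apply: (mulgI (g 1%g)); rewrite -gM !mulg1.
pose piM := isUMagmaMorphism.Build _ _ _ pi_mul.
pose pi : UMagmaMorphism.type B C6C2 := HB.pack (fun a => (g a).2) piM.
apply: (@iso_semidirect_C6C2 _ _ p_pr co6 h f f'K fK pi).
have P_pi (a : B) : a *+ p = 0 -> pi a = 1%g.
  (* On the p-torsion the product is the sum, so that a^p = 1. *)
  move=> ap; have aX n : (a ^+ n)%g = a *+ n.
    elim: n => [|n IHn]; first exact: brace_one.
    rewrite expgS IHn brace_mulE (@lam_torsion_pp p B p_pr co6 h f fK) //.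
      by rewrite -mulrS.
    by rewrite -mulrnA mulnC mulrnA ap mul0rn.
  apply: (@coprime_torsion_eq0 _ p 6) => //; last exact: C6C2_mulrn6.
  by rewrite -[LHS]/((pi a) ^+ p)%g -gmulfXn aX ap -brace_one gmulf1.
move=> a; split=> [pa|]; last exact: P_pi.
pose k (x : 'F_p) := (g (@inP p B h x)).1.
have gP x : g (@inP p B h x) = (k x, 1%g).
  rewrite [LHS]surjective_pairing; congr (_, _).
  by apply: P_pi; apply: inP_torsion.
have k_inj : injective k.
  move=> x y kxy; apply: (@inP_inj p B h f f'K).
  by apply: (can_inj gK); rewrite !gP kxy.
have [k' _ kK'] := injF_bij k_inj.
suff -> : a = @inP p B h (k' (g a).1) by exact: inP_torsion.
apply: (can_inj gK); rewrite gP kK' [LHS]surjective_pairing; congr (_, _).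
exact: pa.
Qed.
End Projection.

(** * Isomorphisms of semidirect products *)

Section BraceIso.
Local Open Scope ring_scope.

Lemma brace_iso_refl A : brace_iso A A.
Proof. by exists id; split=> //; exists id. Qed.

Lemma brace_iso_sym A B : brace_iso A B -> brace_iso B A.
Proof.
case=> f [[g fK gK] fD fM]; exists g.
by split; [exists f|move=> x y; rewrite -{1}[x]gK -{1}[y]gK -fD fK
          |move=> x y; rewrite -{1}[x]gK -{1}[y]gK -fM fK].
Qed.

Lemma brace_iso_trans A B C : brace_iso A B -> brace_iso B C -> brace_iso A C.
Proof.
case=> f [bf fD fM] [g [bg gD gM]]; exists (g \o f).
split; first exact: bij_comp.
  by move=> x y; rewrite /= fD gD.
by move=> x y; rewrite /= fM gM.
Qed.

Lemma gmulf1_group (G H : groupType) (f : {multiplicative G -> H}) :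
  f 1%g = 1%g.
Proof. by apply: (mulgI (f 1%g)); rewrite -gmulfM !mulg1. Qed.

Lemma gmulfXn_group (G H : groupType) (f : {multiplicative G -> H}) x n :
  f (x ^+ n)%g = (f x ^+ n)%g.
Proof.
by elim: n => [|n IHn]; rewrite ?gmulf1_group // !expgS gmulfM IHn.
Qed.

Lemma semidirect_iso p (A A' : leftBraceType)
    (tau : {multiplicative A -> {unit 'F_p}})
    (tau' : {multiplicative A' -> {unit 'F_p}}) (phi : A -> A') :
  bijective phi -> {morph phi : x y / x + y} -> {morph phi : x y / (x * y)%g} ->
  (forall x, tau x = tau' (phi x)) ->
  brace_iso (semidirect tau) (semidirect tau').
Proof.
case=> psi phiK psiK phiD phiM tauE.
exists (fun x : semidirect tau => (x.1, phi x.2) : semidirect tau'); split.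
- exists (fun x : semidirect tau' => (x.1, psi x.2) : semidirect tau);
    by move=> -[a b] /=; rewrite ?phiK ?psiK.
- by move=> x y; congr (_, _); apply: phiD.
- by move=> x y; congr (_, _) => /=; rewrite ?tauE ?phiM.
Qed.
End BraceIso.

(** * The order of the kernel is an isomorphism invariant *)

Section Kernel.
Local Open Scope ring_scope.
Variable p : nat.
Hypothesis p_pr : prime p.

(** Translation by v permutes A, so that the sum of A is unchanged by adding v
    to each of its terms. *)
Lemma mulrn_card (A : finLeftBraceType) (v : A) : v *+ #|A| = 0.
Proof.
have : \sum_(x : A) x = \sum_(x : A) (v + x).
  by apply: reindex_inj; exact: addrI.
by rewrite big_split /= sumr_const -[LHS]add0r => /addIr/esym.
Qed.

Definition centralises_torsion (B : leftBraceType) (x : B) :=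
  forall y, y *+ p = 0 -> (x * y = y * x)%g.

(** The additive p-torsion of the semidirect product is F_p x 0, and (a, b)
    commutes with (1, 0) exactly when tau b * 1 = 1. *)
Lemma centralises_torsionP (A : finLeftBraceType)
    (tau : {multiplicative A -> {unit 'F_p}}) (x : semidirect tau) :
  coprime p #|A| -> centralises_torsion x <-> tau x.2 = 1%g.
Proof.
move=> co; split=> [cx | tx y yp].
  have yp : ((1, 0) : semidirect tau) *+ p = 0.
    have E n : ((1, 0) : semidirect tau) *+ n = (n%:R, 0).
      elim: n => // n IHn; rewrite mulrS IHn.
      by congr (_, _); rewrite ?mulrS ?addr0.
    by rewrite E pchar_Fp_0.
  have := congr1 fst (cx _ yp); rewrite /= -brace_one gmulf1_group /= mul1r mulr1.
  by rewrite [RHS]addrC => /addrI t1; apply: val_inj.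
have y2 : y.2 = 1%g.
  rewrite brace_one; apply: (coprime_torsion_eq0 co _ (mulrn_card _)).
  have E n : (y *+ n).2 = y.2 *+ n by elim: n => // n IHn; rewrite !mulrS -IHn.
  by rewrite -E yp.
case: x y y2 tx {yp} => [x1 x2] [y1 y2] /= -> tx; congr (_, _) => /=; last first.
  by rewrite mulg1 mul1g.
by rewrite tx gmulf1_group /= !mul1r addrC.
Qed.

Lemma iso_centralises_torsion (A B : leftBraceType) (f : A -> B) (x : A) :
  bijective f -> {morph f : x y / x + y} -> {morph f : x y / (x * y)%g} ->
  centralises_torsion x -> centralises_torsion (f x).
Proof.
case=> g fK gK fD fM cx y yp; rewrite -[y]gK -!fM cx //.
have f0 : f 0 = 0 by apply: (addrI (f 0)); rewrite -fD !addr0.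
have fn z n : f (z *+ n) = f z *+ n.
  by elim: n => // n IHn; rewrite !mulrS fD IHn.
by apply: (can_inj fK); rewrite fn gK yp f0.
Qed.

Lemma card_centraliser (A : finType) (tau : A -> {unit 'F_p}) :
  #|[set x : 'F_p * A | tau x.2 == 1%g]| = (p * #|[set b | tau b == 1%g]|)%N.
Proof.
transitivity (#|setX [set: 'F_p] [set b | tau b == 1%g]|); last first.
  by rewrite cardsX cardsT card_Fp.
by apply: eq_card => x; rewrite !inE.
Qed.

(** An isomorphism maps F_p x ker tau, the multiplicative centraliser of the
    additive p-torsion, into F_p x ker tau'. *)
Lemma semidirect_iso_card_ker (A A' : finLeftBraceType)
    (tau : {multiplicative A -> {unit 'F_p}})
    (tau' : {multiplicative A' -> {unit 'F_p}}) :
  coprime p #|A| -> coprime p #|A'| ->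
  brace_iso (semidirect tau) (semidirect tau') ->
  #|[set b | tau b == 1%g]| = #|[set b | tau' b == 1%g]|.
Proof.
suff le_ker (A1 A2 : finLeftBraceType)
    (tau1 : {multiplicative A1 -> {unit 'F_p}})
    (tau2 : {multiplicative A2 -> {unit 'F_p}}) :
    coprime p #|A1| -> coprime p #|A2| ->
    brace_iso (semidirect tau1) (semidirect tau2) ->
    (#|[set b | tau1 b == 1%g]| <= #|[set b | tau2 b == 1%g]|)%N.
  move=> co co' iso; apply/eqP; rewrite eqn_leq !le_ker //.
  exact: brace_iso_sym.
move=> {tau tau' A A'} co co' [f [bf fD fM]].
rewrite -(leq_pmul2l (prime_gt0 p_pr)) -!card_centraliser.
pose F (x : 'F_p * A1) : 'F_p * A2 := f x.
rewrite -(card_imset _ (bij_inj bf : injective F)).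
apply/subset_leq_card/subsetP.
move=> _ /imsetP[x /[!inE] /eqP tx ->]; apply/eqP.
apply/(centralises_torsionP (f x) co')/(iso_centralises_torsion bf fD fM).
exact/(centralises_torsionP (x : semidirect tau1) co).
Qed.
End Kernel.

(** * Normal forms of the actions of C6 x C2 on Z_p *)

Section Actions.
Local Open Scope ring_scope.
Variable p : nat.
Implicit Types c e z : {unit 'F_p}.

Lemma unit_mulC z z' : commute z z'.
Proof. by apply: val_inj; rewrite /= mulrC. Qed.

Section Std.
Variables c e : {unit 'F_p}.
Hypotheses (c3 : (c ^+ 3 = 1)%g) (e2 : (e ^+ 2 = 1)%g).

Definition std_fun (v : C6C2) : {unit 'F_p} := (c ^+ v.1 * e ^+ v.2)%g.

Fact std_funM : {morph std_fun : v w / (v * w)%g}.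
Proof.
move=> [i j] [i' j']; rewrite /std_fun /=.
have -> : (c ^+ (i * i')%g = c ^+ i * c ^+ i')%g.
  by rewrite /= expg_mod ?expgD // (expgM c 3 2) c3 expg1n.
have -> : (e ^+ (j * j')%g = e ^+ j * e ^+ j')%g.
  by rewrite /= expg_mod // expgD.
rewrite -!mulgA; congr (_ * _)%g; rewrite !mulgA; congr (_ * _)%g.
exact: unit_mulC.
Qed.

Definition std : {multiplicative C6C2 -> {unit 'F_p}} :=
  HB.pack std_fun (isMultiplicative.Build _ _ std_fun std_funM).

(** Since c has odd order and e has order at most 2, c^i e^j = 1 only if
    c^i = e^j = 1. *)
Lemma card_ker_std :
  #|[set v | std v == 1%g]| = (6 %/ #[c]%g * (2 %/ #[e]%g))%N.
Proof.
have -> : [set v | std v == 1%g] =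
    setX [set i : 'Z_6 | (#[c]%g %| i)%N] [set j : 'Z_2 | (#[e]%g %| j)%N].
  apply/setP => -[i j]; rewrite !inE !order_dvdn /=.
  rewrite /std_fun; apply/eqP/andP=> [|[/eqP-> /eqP->]]; last exact: mulg1.
  have ej2 : (e ^+ j ^+ 2 = 1)%g by rewrite -expgM mulnC expgM e2 expg1n.
  have ci3 : (c ^+ i ^+ 3 = 1)%g by rewrite -expgM mulnC expgM c3 expg1n.
  move=> ce; suff ej : (e ^+ j = 1)%g by move: ce; rewrite ej mulg1 => ->.
  have := congr1 (fun z => z ^+ 3)%g ce; rewrite /= expgMn;
    last exact: unit_mulC.
  by rewrite ci3 mul1g expgS ej2 mulg1 expg1n.
have order_c : #[c]%g \in pred2 1%N 3%N.
  have /primeP[_ div3] : prime 3 by [].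
  by apply: div3; rewrite order_dvdn c3.
have order_e : #[e]%g \in pred2 1%N 2%N.
  have /primeP[_ div2] : prime 2 by [].
  by apply: div2; rewrite order_dvdn e2.
rewrite cardsX -!sum1dep_card; congr (_ * _)%N.
  by case/pred2P: order_c => ->; rewrite big_mkcond /= !big_ord_recl big_ord0.
by case/pred2P: order_e => ->; rewrite big_mkcond /= !big_ord_recl big_ord0.
Qed.
End Std.

(** Under these hypotheses x and y are the images of the generators (1, 0) and
    (0, 1) under an automorphism of C6 x C2. *)
Lemma iso_change_generators (tau : {multiplicative C6C2 -> {unit 'F_p}})
    (x y : C6C2) c e (c3 : (c ^+ 3 = 1)%g) (e2 : (e ^+ 2 = 1)%g) :
  y *+ 2 = 0 -> (forall v : C6C2, x *+ v.1 + y *+ v.2 = 0 -> v = 0) ->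
  tau x = c -> tau y = e -> brace_iso (semidirect tau) (semidirect (std c3 e2)).
Proof.
move=> y2 free tx ty; pose phi (v : C6C2) : C6C2 := x *+ v.1 + y *+ v.2.
have mulrn_mod (z : C6C2) m n : z *+ n = 0 -> z *+ (m %% n) = z *+ m.
  move=> zn; rewrite [in RHS](divn_eq m n) mulrnDr mulnC mulrnA zn mul0rn.
  by rewrite add0r.
have phiD : {morph phi : v w / v + w}.
  move=> [i j] [i' j']; rewrite /phi /= !mulrn_mod ?C6C2_mulrn6 //.
  by rewrite !mulrnDr addrACA.
have phi_inj : injective phi.
  move=> v w vw; apply/eqP; rewrite -subr_eq0; apply/eqP/free.
  by apply: (addIr (phi w)); rewrite -phiD subrK add0r.
apply: brace_iso_sym.
apply: (semidirect_iso (injF_bij phi_inj) phiD phiD) => -[i j].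
rewrite -[phi _]/(x ^+ i * y ^+ j)%g gmulfM !gmulfXn_group tx ty //.
Qed.

Lemma involution_unit e : (e ^+ 2 = 1)%g -> e = 1%g \/ val e = -1.
Proof.
move/(congr1 val)/eqP; rewrite /= -expr2 sqrf_eq1 => /orP[]/eqP e1.
  by left; apply: val_inj.
by right.
Qed.

(** The involutions (3, 0), (0, 1) and (3, 1) are mapped to 1 or -1, and (3, 1)
    is the sum of the other two: one of them, say a, is mapped to 1.  The new
    generators are x = (4, 0) + a, whose triple is a, so that the cube of tau x
    is 1, and an involution other than a.  The proofs c3 and e2 are universally
    quantified so that representatives can come with proofs of their own. *)
Lemma iso_std (tau : {multiplicative C6C2 -> {unit 'F_p}}) :
  exists c e, [/\ (c ^+ 3 = 1)%g, (e ^+ 2 = 1)%g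
    & forall (c3 : (c ^+ 3 = 1)%g) (e2 : (e ^+ 2 = 1)%g),
        brace_iso (semidirect tau) (semidirect (std c3 e2))].
Proof.
have main (x y : C6C2) : tau (x *+ 3) = 1%g -> y *+ 2 = 0 ->
    (forall v : C6C2, (x *+ v.1 + y *+ v.2 == 0) ==> (v == 0)) ->
    exists c e, [/\ (c ^+ 3 = 1)%g, (e ^+ 2 = 1)%g
      & forall (c3 : (c ^+ 3 = 1)%g) (e2 : (e ^+ 2 = 1)%g),
          brace_iso (semidirect tau) (semidirect (std c3 e2))].
  move=> tx y2 free; exists (tau x), (tau y); split=> [||c3 e2].
  - by rewrite -gmulfXn_group.
  - by rewrite -gmulfXn_group [(y ^+ 2)%g]y2 gmulf1_group.
  by apply: (@iso_change_generators _ x y) => // v /eqP /(implyP (free v))/eqP.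
have tau_tors (x : C6C2) : x *+ 2 = 0 -> tau x = 1%g \/ val (tau x) = -1.
  move=> x2; apply: involution_unit.
  by rewrite -gmulfXn_group [(x ^+ 2)%g]x2 gmulf1_group.
have [|t1|t1] := tau_tors (inZp 3, 0); first exact/eqP.
  apply: (main (1, 0) (0, 1)); [|exact/eqP|exact: C6C2_forall].
  by rewrite -t1; congr (tau _); apply/eqP.
have [|t2|t2] := tau_tors (0, 1); first exact/eqP.
  apply: (main (inZp 4, 1) (inZp 3, 0)); [|exact/eqP|exact: C6C2_forall].
  by rewrite -t2; congr (tau _); apply/eqP.
apply: (main (1, 1) (0, 1)); [|exact/eqP|exact: C6C2_forall].
have -> : (1, 1) *+ 3 = ((inZp 3, 0) : C6C2) + (0, 1) by apply/eqP.
rewrite -[tau _]/(tau (((inZp 3, 0)%R : C6C2) * (0, 1)%R)%g).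
by rewrite gmulfM; apply: val_inj; rewrite /= t1 t2 mulrNN mulr1.
Qed.

(** The automorphism (i, j) |-> (- i, j) inverts c and leaves e unchanged. *)
Lemma iso_stdV c e (c3 : (c ^+ 3 = 1)%g) (e2 : (e ^+ 2 = 1)%g)
    (c3' : (c^-1 ^+ 3 = 1)%g) :
  brace_iso (semidirect (std c3 e2)) (semidirect (std c3' e2)).
Proof.
apply: (@iso_change_generators _ (- 1, 0) (0, 1)) => /=.
- exact/eqP.
- by move=> v /eqP v0; apply/eqP/(implyP _ v0); move: (v); apply: C6C2_forall.
- rewrite -[LHS]/(c ^+ 5 * 1)%g mulg1; apply/esym/mulg1_eq.
  by rewrite -expgS (expgM c 3 2) c3 expg1n.
by rewrite -[LHS]/(1 * e)%g mul1g.
Qed.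

(** From w^2 + w + 1 = 0 follows z^3 - 1 = (z - 1) (z - w) (z - w^2). *)
Lemma cube_roots_of_unity (w z : {unit 'F_p}) :
  (w ^+ 3 = 1)%g -> w <> 1%g -> (z ^+ 3 = 1)%g ->
  [\/ z = 1, z = w | z = w^-1]%g.
Proof.
move=> w3 w1 z3.
have val3 (u : {unit 'F_p}) : (u ^+ 3 = 1)%g -> val u ^+ 3 = 1.
  by move/(congr1 val).
have w21 : val w ^+ 2 + val w + 1 = 0.
  have w1' : val w - 1 != 0.
    by rewrite subr_eq0; apply/eqP => w1'; apply: w1; apply: val_inj.
  apply: (mulfI w1'); rewrite mulr0 -[RHS](subrr 1) -{3}(val3 w w3); ring.
have : (val z - 1) * ((val z - val w) * (val z - val w ^+ 2)) = 0.
  transitivity ((val z ^+ 3 - val w ^+ 3)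
    + (val w ^+ 2 + val w + 1) * (val z * val w - val z ^+ 2)); first by ring.
  by rewrite w21 !val3 // mul0r subrr addr0.
move/eqP; rewrite !mulf_eq0 !subr_eq0 => /or3P[]/eqP zE.
- by constructor 1; apply: val_inj.
- by constructor 2; apply: val_inj.
by constructor 3; apply/esym/mulg1_eq/val_inj; rewrite /= zE -exprS val3.
Qed.
End Actions.

(** * Counting the braces *)

Section Classification.
Variable p : nat.
Hypotheses (p_pr : prime p) (p_ge7 : 7 <= p).

Lemma card_C6C2 : #|{: C6C2}| = 12.
Proof. by rewrite card_prod !card_ord. Qed.

Lemma coprime_small m : all (fun q => q < 7) (primes m) -> 0 < m -> coprime p m.
Proof.
move=> /allP sm m_gt0; rewrite prime_coprime //; apply/negP => pm.
by have := sm p; rewrite mem_primes p_pr m_gt0 pm ltnNge p_ge7 => /(_ isT).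
Qed.

Lemma semidirect_C6C2_brace (tau : {multiplicative C6C2 -> {unit 'F_p}}) :
  C6C2_brace p (semidirect tau).
Proof.
split; first by exists id => //; exists id.
by exists tau, id => //; exists id.
Qed.

Lemma semidirect_has_kernel_order
    (tau : {multiplicative C6C2 -> {unit 'F_p}}) k :
  #|[set v | tau v == 1%g]| = k -> has_kernel_order p k (semidirect tau).
Proof.
have co12 : coprime p 12 by exact: coprime_small.
move=> <-; split=> [|B' tau' [B'12 /brace_iso_sym iso]].
  by exists C6C2, tau; split; [exact: card_C6C2|exact: brace_iso_refl].
by apply: semidirect_iso_card_ker iso => //; rewrite ?card_C6C2 ?B'12.
Qed.

(** The function assumed injective is the order of the kernel, as computed by
    card_ker_std. *)
Lemma iso_representatives_std n (c e : 'I_n -> {unit 'F_p})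
    (c3 : forall i, (c i ^+ 3 = 1)%g) (e2 : forall i, (e i ^+ 2 = 1)%g) :
  injective (fun i => 6 %/ #[c i]%g * (2 %/ #[e i]%g)) ->
  (forall c' e' : {unit 'F_p}, (c' ^+ 3 = 1)%g -> (e' ^+ 2 = 1)%g ->
     exists2 i, e' = e i & c' = c i \/ c' = (c i)^-1%g) ->
  iso_representatives (C6C2_brace p) (fun i => semidirect (std (c3 i) (e2 i))).
Proof.
move=> k_inj surj; split=> [i|i j iso|B /C6C2_brace_iso_semidirect[] //].
- exact: semidirect_C6C2_brace.
- apply: k_inj; rewrite -!(card_ker_std (c3 _) (e2 _)).
  by apply: semidirect_iso_card_ker iso => //; rewrite card_C6C2 coprime_small.
- exact: coprime_small.
move=> tau isoB; have [c' [e' [c'3 e'2 iso]]] := iso_std tau.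
have [i ei ci] := surj c' e' c'3 e'2; exists i; apply: brace_iso_trans isoB _.
case: ci iso c'3 e'2 => -> ; rewrite {}ei => iso c'3 e'2; first exact: iso.
apply: brace_iso_trans (brace_iso_sym (iso_stdV (c3 i) (e2 i) c'3)); exact: iso.
Qed.

Lemma unit_minus1 : (-1 : 'F_p)%R \is a GRing.unit.
Proof. by rewrite unitrN unitr1. Qed.

Definition minus1 : {unit 'F_p} := FinRing.Unit unit_minus1.

Lemma minus1_sqr : (minus1 ^+ 2 = 1)%g.
Proof. by apply: val_inj; rewrite /= mulrNN mulr1. Qed.

Lemma order_minus1 : #[minus1]%g = 2.
Proof.
apply: nt_prime_order minus1_sqr _ => //.
apply/eqP => /(congr1 val) /= /eqP.
rewrite eq_sym -subr_eq0 opprK -[(1 + 1)%R]/(2%:R)%R.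
by rewrite -(dvdn_pcharf (pchar_Fp p_pr)) => /dvdn_leq; lia.
Qed.

Lemma is_direct_product_std (c e : {unit 'F_p})
    (c3 : (c ^+ 3 = 1)%g) (e2 : (e ^+ 2 = 1)%g) :
  c = 1%g -> e = 1%g -> @is_direct_product p (semidirect (std c3 e2)).
Proof.
move=> c1 e1; exists C6C2, (std c3 e2); split; last first.
  by move=> v; rewrite /= /std_fun c1 e1 !expg1n mulg1.
by split; [exact: card_C6C2|exact: brace_iso_refl].
Qed.

(** Here 3 is prime to p - 1, so that 1 is the only cube root of unity. *)
Lemma classification_2mod3 : p = 2 %[mod 3] ->
  exists B : 'I_2 -> leftBraceType,
    [/\ iso_representatives (C6C2_brace p) B,
        is_direct_product p (B (inord 0)) & has_kernel_order p 6 (B (inord 1))].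
Proof.
move=> p_mod; pose e (i : 'I_2) := (minus1 ^+ i)%g.
have c3 (i : 'I_2) : (1 ^+ 3 = 1 :> {unit 'F_p})%g by rewrite expg1n.
have e2 i : (e i ^+ 2 = 1)%g.
  by rewrite /e -expgM mulnC expgM minus1_sqr expg1n.
exists (fun i => semidirect (std (c3 i) (e2 i))); split.
- apply: iso_representatives_std.
    move=> i j; rewrite /e order1; case: i j => [[|[|//]] ?] [[|[|//]] ?] //=;
      rewrite ?expg0 ?expg1 ?order1 ?order_minus1 // => _; exact: val_inj.
  move=> c' e' c'3 /involution_unit e'1.
  have c'1 : c' = 1%g.
    (* The order of c' divides both 3 and the order p - 1 of the group. *)
    apply/eqP; rewrite -order_eq1 -dvdn1.
    have <- : gcdn 3 p.-1 = 1.
      by apply/eqP; rewrite -/(coprime _ _) prime_coprime //; lia.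
    rewrite dvdn_gcd !order_dvdn c'3 eqxx /=.
    have := card_finField_unit 'F_p; rewrite card_Fp // => <-.
    by rewrite expg_cardG ?inE.
  case: e'1 => e'E.
    by exists ord0; [rewrite /e expg0|left].
  exists (lift ord0 ord0); last by left.
  by apply: val_inj; rewrite /e expg1 e'E.
- by apply: is_direct_product_std => //; rewrite /e inordK.
apply: semidirect_has_kernel_order; rewrite card_ker_std //.
by rewrite /e inordK // order1 order_minus1.
Qed.

(** Here 3 divides p - 1, and w is a unit of order 3. *)
Lemma classification_1mod3 : p = 1 %[mod 3] ->
  exists B : 'I_4 -> leftBraceType,
    [/\ iso_representatives (C6C2_brace p) B,
        is_direct_product p (B (inord 0)), has_kernel_order p 2 (B (inord 1)),
        has_kernel_order p 6 (B (inord 2))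
      & has_kernel_order p 4 (B (inord 3))].
Proof.
move=> p_mod.
have [|w _ ow] := @Cauchy _ 3 [set: {unit 'F_p}]%G isT.
  by rewrite card_finField_unit card_Fp //; lia.
pose c (i : 'I_4) := nth 1%g [:: 1; w; 1; w]%g i.
pose e (i : 'I_4) := nth 1%g [:: 1; minus1; minus1; 1]%g i.
have w3 : (w ^+ 3 = 1)%g by rewrite -ow expg_order.
have c3 i : (c i ^+ 3 = 1)%g.
  by case: i => [[|[|[|[|//]]]] ?]; rewrite /c /= ?expg1n.
have e2 i : (e i ^+ 2 = 1)%g.
  by case: i => [[|[|[|[|//]]]] ?]; rewrite /e /= ?expg1n ?minus1_sqr.
exists (fun i => semidirect (std (c3 i) (e2 i))); split.
- apply: iso_representatives_std.
    move=> i j; rewrite /c /e.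
    case: i j => [[|[|[|[|//]]]] ?] [[|[|[|[|//]]]] ?] //=;
      rewrite ?order1 ?order_minus1 ?ow // => _; exact: val_inj.
  move=> c' e' c'3 /involution_unit e'1.
  have w1 : w <> 1%g by move=> w1; rewrite w1 order1 in ow.
  have [i ic ie] : exists2 i : 'I_4,
      (c' = 1%g /\ c i = 1%g \/ c' <> 1%g /\ c i = w) & e' = e i.
    case: (eqVneq c' 1%g) => [c1|/eqP c1]; case: e'1 => e1.
    - by exists (inord 0); rewrite /c /e inordK //; left.
    - exists (inord 2); rewrite /c /e inordK //; first by left.
      by apply: val_inj; rewrite e1.
    - by exists (inord 3); rewrite /c /e inordK //; right.
    - exists (inord 1); rewrite /c /e inordK //; first by right.
      by apply: val_inj; rewrite e1.
  exists i => //; case: ic => [[-> ->]|[c'1 ->]]; first by left.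
  by case: (cube_roots_of_unity w3 w1 c'3) => // ->; [left|right].
- by apply: is_direct_product_std => //; rewrite /c /e inordK.
- apply: semidirect_has_kernel_order; rewrite card_ker_std //.
  by rewrite /c /e inordK //= ow order_minus1.
- apply: semidirect_has_kernel_order; rewrite card_ker_std //.
  by rewrite /c /e inordK //= order1 order_minus1.
apply: semidirect_has_kernel_order; rewrite card_ker_std //.
by rewrite /c /e inordK //= ow order1.
Qed.
End Classification.

Theorem proposition14 (p : nat) (p_prime : prime p) (p_ge7 : 7 <= p) :
  [/\ p = 11 %[mod 12] ->
    exists B : 'I_2 -> leftBraceType,
      [/\ iso_representatives (C6C2_brace p) B,
          is_direct_product p (B (inord 0)) & has_kernel_order p 6 (B (inord 1))],
      p = 7 %[mod 12] ->
    exists B : 'I_4 -> leftBraceType,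
      [/\ iso_representatives (C6C2_brace p) B,
          is_direct_product p (B (inord 0)), has_kernel_order p 2 (B (inord 1)),
          has_kernel_order p 6 (B (inord 2))
        & has_kernel_order p 4 (B (inord 3))],
      p = 5 %[mod 12] ->
    exists B : 'I_2 -> leftBraceType,
      [/\ iso_representatives (C6C2_brace p) B,
          is_direct_product p (B (inord 0)) & has_kernel_order p 6 (B (inord 1))]
    & p = 1 %[mod 12] ->
    exists B : 'I_4 -> leftBraceType,
      [/\ iso_representatives (C6C2_brace p) B,
          is_direct_product p (B (inord 0)), has_kernel_order p 2 (B (inord 1)),
          has_kernel_order p 6 (B (inord 2))
        & has_kernel_order p 4 (B (inord 3))]].
Proof.
split=> p_mod.
- by apply: classification_2mod3 => //; lia.
- by apply: classification_1mod3 => //; lia.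
- by apply: classification_2mod3 => //; lia.
by apply: classification_1mod3 => //; lia.
Qed.
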